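(* For any dendriform poset $\mathbf P=\{P_n\}_{n\ge1}$ and any $m\ge 1$, the vector space $\mathrm{Ord}^m(\mathbf P)$, equipped with the products $*_i$, for $0\le i\le m$, is a $\mathrm{Dyck}^m$ algebra.
   Context: $\mathbb K$ is a field and $\mathbb K[X]$ is the $\mathbb K$-vector space spanned by (with basis) the set $X$. For $m\ge1$, a $\mathrm{Dyck}^m$ algebra is a $\mathbb K$-vector space $D$ with $m+1$ binary operations $*_i:D\otimes D\to D$, $0\le i\le m$, such that for all $x,y,z\in D$: $x*_i(y*_jz)=(x*_iy)*_jz$ for $0\le i<j\le m$; and $\sum_{j=0}^i x*_i(y*_jz)=\sum_{k=i}^m (x*_ky)*_iz$ for $0\le i\le m$. For elements $a,b$ of a poset, $[a;b]=\{u\mid a\le u\le b\}$. A dendriform poset is a family of partially ordered sets $\mathbf P=\{P_n\}_{n\ge1}$, equipped with four binary graded products $/,\perp,\top,\backslash$, satisfying: (1) for $n,r\ge1$, the maps $/,\perp,\top,\backslash:P_n\times P_r\to P_{n+r}$ preserve the orders (where $P_n\times P_r$ has the componentwise order); (2) for any $x\in P_n$ and $y\in P_r$, the interval $[x/y;x\backslash y]$ is the disjoint union of the intervals $[x/y;x\perp y]$ and $[x\top y;x\backslash y]$; (3) for any $x\in P_n$, $y\in P_r$, $z\in P_s$ there exists a bijective order preserving map $\varphi_{x,y,z}$ from the set $L(x,y,z)=\{(u,v)\in P_{n+r}\times P_{n+r+s}\mid x/y\le u\le x\backslash y,\ u/z\le v\le u\backslash z\}$ to the set $R(x,y,z)=\{(u,v)\in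 P_{r+s}\times P_{n+r+s}\mid y/z\le u\le y\backslash z,\ x/u\le v\le x\backslash u\}$, such that (a) the restriction of $\varphi_{x,y,z}$ to $\{(u,v)\in P_{n+r}\times P_{n+r+s}\mid x/y\le u\le x\backslash y,\ u/z\le v\le u\perp z\}$ gives a bijection with $\{(u,v)\in P_{r+s}\times P_{n+r+s}\mid y/z\le u\le y\perp z,\ x/u\le v\le x\perp u\}$; (b) the restriction of $\varphi_{x,y,z}$ to $\{(u,v)\in P_{n+r}\times P_{n+r+s}\mid x\top y\le u\le x\backslash y,\ u\top z\le v\le u\backslash z\}$ gives a bijection with $\{(u,v)\in P_{r+s}\times P_{n+r+s}\mid y/z\le u\le y\backslash z,\ x\top u\le v\le x\backslash u\}$; (4) if there exist $u\le v$ in $P_{n+r}$ satisfying $x/y\le u\le x\backslash y$ and $z/w\le v\le z\backslash w$, for some $x,z\in P_n$ and $y,w\in P_r$, then $x\le z$ in $P_n$ and $y\le w$ in $P_r$; (5) if there exist $u\le v$ in $P_{n+r}$ satisfying $x/y\le u\le x\perp y$ and $x\top y\le v\le x\backslash y$, for some $x\in P_n$ and $y\in P_r$, then $v\not\le u$. For $n\ge1$, $\mathrm{Simp}(\mathbf P)_n^m=\{(x_1,\dots,x_m)\in P_n^m\mid x_1\le\dots\le x_m\}$, and $\mathrm{Ord}^m(\mathbf P)=\bigoplus_{n\ge1}\mathbb K[\mathrm{Simp}(\mathbf P)_n^m]$. For $\underline x=(x_1,\dots,x_m)\in\mathrm{Simp}(\mathbf P)_n^m$, $\underline y=(y_1,\dots,y_m)\in\mathrm{Simp}(\mathbf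 P)_r^m$ and $0\le i\le m$, let $\mathcal I^i(\underline x,\underline y)$ be the set of all $\underline u=(u_1,\dots,u_m)\in\mathrm{Simp}(\mathbf P)_{n+r}^m$ such that $x_j/y_j\le u_j\le x_j\perp y_j$ for $1\le j\le m-i$ and $x_j\top y_j\le u_j\le x_j\backslash y_j$ for $m-i<j\le m$. The product $*_i:\mathrm{Ord}^m(\mathbf P)\otimes\mathrm{Ord}^m(\mathbf P)\to\mathrm{Ord}^m(\mathbf P)$ is the linear extension of $\underline x*_i\underline y=\sum_{\underline u\in\mathcal I^i(\underline x,\underline y)}\underline u$.
   Formalization: The printed axioms make the claim false; here φ in (3) must fix the second coordinate v, and (5) is required for u in [x/y;x⊥y], v in [z⊤w;z\w] with possibly different pairs (x,y), (z,w); the intervals [x/y;x\y] are assumed finite so that the sums make sense. *)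

(* Defs.v *)
From HB Require Import structures.
From mathcomp Require Import all_boot all_order all_algebra.
From mathcomp Require Import finmap monalg.
From mathcomp Require Import boolp classical_sets functions cardinality fsbigop.
From mathcomp Require Import set_interval.

Set Implicit Arguments.
Unset Strict Implicit.
Unset Printing Implicit Defensive.

Import Order.TTheory GRing.Theory.

Local Open Scope classical_set_scope.
Local Open Scope ring_scope.

(* The relations between the operations *_0, ..., *_m require the operations
   to be bilinear, i.e. to be linear maps on the tensor square. *)
Record is_Dyck_algebra (K : fieldType) (m : nat) (D : lmodType K)
    (op : 'I_m.+1 -> D -> D -> D) : Prop := {
  Dyck_linearl : forall (i : 'I_m.+1) (y : D), linear (op i ^~ y) ;
  Dyck_linearr : forall (i : 'I_m.+1) (x : D), linear (op i x) ;
  Dyck_assoc : forall (i j : 'I_m.+1) (x y z : D), (i < j)%N ->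
    op i x (op j y z) = op j (op i x y) z ;
  Dyck_sum : forall (i : 'I_m.+1) (x y z : D),
    \sum_(j < m.+1 | (j <= i)%N) op i x (op j y z) =
    \sum_(k < m.+1 | (i <= k)%N) op i (op k x y) z
}.

(* Gradings start in degree 1, so P n is the component of degree n + 1; the
   product of elements of degrees n + 1 and r + 1 has degree (n + r).+1 + 1. *)
Record graded_poset4 (d : Order.disp_t) := {
  gposet :> nat -> porderType d ;
  slash : forall n r, gposet n -> gposet r -> gposet (n + r).+1 ;
  perp : forall n r, gposet n -> gposet r -> gposet (n + r).+1 ;
  topp : forall n r, gposet n -> gposet r -> gposet (n + r).+1 ;
  backslash : forall n r, gposet n -> gposet r -> gposet (n + r).+1
}.

Section Intervals.
Variables (d : Order.disp_t) (P : graded_poset4 d) (n r : nat).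
Variables (x : P n) (y : P r).

Definition full : set (P (n + r).+1) := `[slash x y, backslash x y]%classic.
Definition lower : set (P (n + r).+1) := `[slash x y, perp x y]%classic.
Definition upper : set (P (n + r).+1) := `[topp x y, backslash x y]%classic.

End Intervals.

Section Pairs.
Variables (d : Order.disp_t) (P : graded_poset4 d) (n r s : nat).
Variables (x : P n) (y : P r) (z : P s).

Definition Lset : set (P (n + r).+1 * P ((n + r).+1 + s).+1) :=
  full x y `*`` (fun u => full u z).
Definition Rset : set (P (r + s).+1 * P (n + (r + s).+1).+1) :=
  full y z `*`` (fun u => full x u).

Definition Llower : set (P (n + r).+1 * P ((n + r).+1 + s).+1) :=
  full x y `*`` (fun u => lower u z).
Definition Rlower : set (P (r + s).+1 * P (n + (r + s).+1).+1) :=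
  lower y z `*`` (fun u => lower x u).

Definition Lupper : set (P (n + r).+1 * P ((n + r).+1 + s).+1) :=
  upper x y `*`` (fun u => upper u z).
Definition Rupper : set (P (r + s).+1 * P (n + (r + s).+1).+1) :=
  full y z `*`` (fun u => upper x u).

End Pairs.

Definition preserves_orders (d : Order.disp_t) (P : nat -> porderType d)
    (op : forall n r, P n -> P r -> P (n + r).+1) : Prop :=
  forall n r (x x' : P n) (y y' : P r),
    (x <= x')%O -> (y <= y')%O -> (op n r x y <= op n r x' y')%O.

(* Two conventions matter below.
   - The bijection from Lset to Rset lies over the common second factor: it
     sends (u, v) to some (u', v). The two copies of v live in components whose
     indices are equal only up to associativity of addition, hence they are
     compared in the disjoint union of the components. A mere order preserving
     bijection would not relate the sums of the second coordinates.
   - dp_separated compares the lower interval of one pair (x, y) with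
     the upper interval of a possibly different pair (z, w). For
     (z, w) = (x, y) it already follows from the disjointness in dp_split. *)
Record is_dendriform_poset (d : Order.disp_t) (P : graded_poset4 d) : Prop := {
  dp_slash : preserves_orders (@slash d P) ;
  dp_perp : preserves_orders (@perp d P) ;
  dp_topp : preserves_orders (@topp d P) ;
  dp_backslash : preserves_orders (@backslash d P) ;
  dp_split : forall n r (x : P n) (y : P r),
    full x y = lower x y `|` upper x y /\ lower x y `&` upper x y = set0 ;
  dp_assoc : forall n r s (x : P n) (y : P r) (z : P s),
    exists phi : P (n + r).+1 * P ((n + r).+1 + s).+1 ->
                 P (r + s).+1 * P (n + (r + s).+1).+1,
      [/\ set_bij (Lset x y z) (Rset x y z) phi,
          forall p q, Lset x y z p -> Lset x y z q ->
            (p.1 <= q.1)%O -> (p.2 <= q.2)%O ->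
            ((phi p).1 <= (phi q).1)%O /\ ((phi p).2 <= (phi q).2)%O,
          forall p, Lset x y z p ->
            Tagged (fun k => P k) (phi p).2 = Tagged (fun k => P k) p.2,
          set_bij (Llower x y z) (Rlower x y z) phi &
          set_bij (Lupper x y z) (Rupper x y z) phi] ;
  dp_monotone : forall n r (x z : P n) (y w : P r) (u v : P (n + r).+1),
    (u <= v)%O -> full x y u -> full z w v -> (x <= z)%O /\ (y <= w)%O ;
  dp_separated : forall n r (x z : P n) (y w : P r) (u v : P (n + r).+1),
    lower x y u -> upper z w v -> ~ (v <= u)%O
}.

Section Ord.
Variables (K : fieldType) (d : Order.disp_t) (P : graded_poset4 d) (m : nat).

Definition Simp (n : nat) := {t : m.-tuple (P n) | sorted <=%O t}.

(* K[X] is the space {malg K[X]} of finitely supported functions X -> K; the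
   direct sum over n of the K[Simp n] is K[X] for X the disjoint union of the
   Simp n. *)
Definition Ord := {malg K[{n : nat & Simp n}]}.
HB.instance Definition _ := GRing.Lmodule.on Ord.

(* The entries of a tuple are numbered from 0, so that x_j is entry j - 1. *)
Definition Iset (i : 'I_m.+1) n r (x : Simp n) (y : Simp r) :
    set (Simp (n + r).+1) :=
  [set u | forall j : 'I_m,
     let xj := tnth (val x) j in let yj := tnth (val y) j in
     (if (j < m - i)%N then lower xj yj else upper xj yj) (tnth (val u) j)].

(* This sum over a set is 0 by convention when the set is infinite; Iset is
   finite as soon as the intervals full x y are. *)
Definition Ord_basis_mul (i : 'I_m.+1) (a b : {n : nat & Simp n}) : Ord :=
  \sum_(u \in Iset i (tagged a) (tagged b)) (<< Tagged Simp u >> : Ord).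

Definition Ord_mul (i : 'I_m.+1) (f g : Ord) : Ord :=
  \sum_(a <- msupp f) \sum_(b <- msupp g)
    (f@_a * g@_b) *: Ord_basis_mul i a b.

End Ord.

(* Main.v *)
Require Import Defs.
From HB Require Import structures.
From mathcomp Require Import all_boot all_order all_algebra.
From mathcomp Require Import finmap monalg.
From mathcomp Require Import boolp classical_sets functions cardinality fsbigop.

(** The idea is to read the axioms of a dendriform poset as statements about
single elements w of the poset, and the Dyck relations as statements about
single chains, entry by entry.

Say that w is a lower, or an upper, product of x and y when it lies between
x/y and x perp y, or between x top y and x\y; this is [side true], or
[side false]. By the monotonicity axiom, w and the degree of x determine x and y
([side_factors]), and by the separation axiom w is not both lower and upper
([side_disjoint]). Hence a w which occurs in
(x . y) . z does so through a unique intermediate u, and has a well defined type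
(b1, b2): u is a lower or upper product of x and y, and w is one of u and z. The
same holds for x . (y . z). The associativity bijection lies over w, so the two
bracketings reach the same w, and its compatibility with lower and upper parts
relates the two types as follows, the left being (x . y) . z and the right
x . (y . z):

- (any, lower) on the left is (lower, lower) on the right ([triple_lower]);
- (upper, upper) on the left is (any, upper) on the right ([triple_upper]);
- what is left over, (lower, upper) on the left, has to be (upper, lower) on the
  right ([triple_middle]).

A chain w occurs in x *_i y iff its first m - i entries are lower and the others
upper. Given a chain w all of whose entries occur in one of the bracketings, the
intermediate entries increase with those of w by the monotonicity axiom, so they
form a chain ([left_triple_chain], [right_triple_chain]). By separation, a lower
entry is never preceded by an upper one ([side_lower_down]), so the intermediate
chain occurs in exactly one *_k ([in_product_exists], [in_product_index]). For
i < j there is at least one index k with m - j <= k < m - i, where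
[triple_middle] applies; it pins down the type of the intermediate chain where
the relations above leave it open, and x *_i (y *_j z) = (x *_i y) *_j z. When
the outer product is *_i on both sides, the intermediate chain may change
from lower to upper anywhere before m - i in (x . y) . z and after m - i in
x . (y . z); these are the sums over k >= i and over j <= i ([chain_triple_sum]).

Finally, as intermediate chains are unique, each coefficient of a triple
product of basis elements is 0 or 1 ([mcoeff_Ord_mul_left],
[mcoeff_Ord_mul_right]), so that the equivalences above are equalities of
coefficients, and trilinearity concludes. *)

Set Implicit Arguments.
Unset Strict Implicit.
Unset Printing Implicit Defensive.

Import Order.TTheory GRing.Theory.

Local Open Scope ring_scope.

(** * Products in the disjoint union of the components *)

Lemma Tagged_inj (I : eqType) (T : I -> eqType) i : injective (@Tagged I i T).
Proof. by move=> x y /eqP; rewrite eq_Tagged => /eqP. Qed.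

Section Pointwise.
Variables (d : Order.disp_t) (P : graded_poset4 d).

(** The degrees of (x . y) . z and x . (y . z) agree only up to associativity of
addition; in the disjoint union of the components the two can be compared. *)
Definition elt := {k : nat & P k}.
Definition embed n (x : P n) : elt := Tagged (fun k => P k) x.

Definition tle (a b : elt) : Prop :=
  exists n (x y : P n), [/\ a = embed x, b = embed y & (x <= y)%O].

Definition side (b : bool) (x y w : elt) : Prop :=
  exists2 v, (if b then lower (tagged x) (tagged y)
              else upper (tagged x) (tagged y)) v & w = embed v.

Lemma embed_inj n : injective (@embed n).
Proof. exact: Tagged_inj. Qed.

Lemma tle_tag a b : tle a b -> tag a = tag b.
Proof. by case=> n [? [? [-> -> _]]]. Qed.

Lemma tle_refl a : tle a a.
Proof. by case: a => n x; exists n, x, x. Qed.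

Lemma tle_anti a b : tle a b -> tle b a -> a = b.
Proof.
move=> [n [x [y [-> -> xy]]]] [k [x' [y' [/[dup] + exx eyy]]]].
move=> /(congr1 tag)/= nk; subst k.
move: exx eyy => /embed_inj <- /embed_inj <- yx.
by congr embed; apply/le_anti; rewrite xy yx.
Qed.

Lemma tle_embed n (x y : P n) : tle (embed x) (embed y) -> (x <= y)%O.
Proof.
move=> [k [x' [y' [/[dup] + exx eyy xy]]]].
move=> /(congr1 tag)/= nk; subst k.
by move: exx eyy xy => /embed_inj <- /embed_inj <-.
Qed.

Hypothesis P_dendriform : is_dendriform_poset P.

Lemma full_side n r (x : P n) (y : P r) v :
  full x y v <-> exists b, side b (embed x) (embed y) (embed v).
Proof.
have [-> _] := dp_split P_dendriform x y; split.
  by move=> [xv|xv]; [exists true|exists false]; exists v.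
by move=> [[] [u uxy /embed_inj ->]]; [left|right].
Qed.

Lemma side_embed b n r (x : P n) (y : P r) v :
  side b (embed x) (embed y) (embed v) <->
  (if b then lower x y else upper x y) v.
Proof. by split=> [[u + /embed_inj ->]|xv] //; exists v. Qed.

Lemma side_tag b x y w : side b x y w -> tag w = (tag x + tag y).+1.
Proof. by case=> v _ ->. Qed.

Lemma side_tag_right b b' x y w x' y' w' :
  side b x y w -> side b' x' y' w' -> tag x = tag x' -> tag w = tag w' ->
  tag y = tag y'.
Proof.
move=> s s' t; rewrite (side_tag s) (side_tag s') t => -[].
exact: addnI.
Qed.

Lemma side_mono b b' x y w x' y' w' :
  side b x y w -> side b' x' y' w' -> tag x = tag x' -> tle w w' ->
  tle x x' /\ tle y y'.
Proof.
move=> s s' t le_ww'.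
have t' := side_tag_right s s' t (tle_tag le_ww').
case: x y x' y' s s' t t' => [n x] [r y] [k x'] [l y'] s s' /= ? ?; subst k l.
have [v _ wv] := s; have [v' _ wv'] := s'; subst w w'.
have fv : full x y v by apply/full_side; exists b.
have fv' : full x' y' v' by apply/full_side; exists b'.
have [xx yy] := dp_monotone P_dendriform (tle_embed le_ww') fv fv'.
by split; [exists n, x, x'|exists r, y, y'].
Qed.

(** Monotonicity, used in both directions for the same w. *)
Lemma side_factors b b' x y x' y' w :
  side b x y w -> side b' x' y' w -> tag x = tag x' -> x = x' /\ y = y'.
Proof.
move=> s s' t; have [xx yy] := side_mono s s' t (tle_refl w).
have [xx' yy'] := side_mono s' s (esym t) (tle_refl w).
by split; apply: tle_anti.
Qed.

Lemma side_separated x y u x' y' v :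
  side true x y u -> side false x' y' v -> tag x = tag x' -> ~ tle v u.
Proof.
move=> s s' t le_vu.
have t' := side_tag_right s s' t (esym (tle_tag le_vu)).
case: x y x' y' s s' t t' => [n x] [r y] [k x'] [l y'] + + /= ? ?; subst k l.
move=> [u0 lu eu] [v0 uv ev]; subst u v.
exact: (dp_separated P_dendriform lu uv) (tle_embed le_vu).
Qed.

Lemma side_disjoint b b' x y w : side b x y w -> side b' x y w -> b = b'.
Proof.
case: b; case: b' => // s s'.
  by case: (side_separated s s' erefl (tle_refl w)).
by case: (side_separated s' s erefl (tle_refl w)).
Qed.

(** The pair [(b1, b2)] is the type of [w] as an element of (x . y) . z: the part
for the inner product, then for the outer one. *)
Definition left_triple b1 b2 (x y z w : elt) :=
  exists2 u, side b1 x y u & side b2 u z w.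
(** Likewise for x . (y . z). *)
Definition right_triple b1 b2 (x y z w : elt) :=
  exists2 u, side b1 y z u & side b2 x u w.

(** The associativity bijection fixes the second coordinate, so its existence
says that both bracketings reach the same elements. *)
Lemma triple_any x y z w :
  (exists b1 b2, left_triple b1 b2 x y z w) <->
  (exists b1 b2, right_triple b1 b2 x y z w).
Proof.
case: x y z => [n x] [r y] [s z].
have [phi [[fphi _ sphi] _ tphi _ _]] := dp_assoc P_dendriform x y z.
have {}tphi p : Lset x y z p -> embed (phi p).2 = embed p.2 := tphi p.
split.
  move=> [b1 [b2 [_ [u su ->] [v sv ->]]]].
  have Luv : Lset x y z (u, v).
    by split=> /=; apply/full_side; [exists b1; exists u|exists b2; exists v].
  have := tphi _ Luv; have [] := fphi _ Luv.
  case: (phi _) => u' v' /= /full_side[b1' su'] /full_side[b2' sv'] <-.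
  by exists b1', b2', (embed u').
move=> [b1 [b2 [_ [u su ->] [v sv ->]]]].
have Ruv : Rset x y z (u, v).
  by split=> /=; apply/full_side; [exists b1; exists u|exists b2; exists v].
have [[u' v'] Luv' ephi] := sphi _ Ruv.
have := tphi _ Luv'; rewrite ephi /= => ->.
have [/= /full_side[b1' su'] /full_side[b2' sv']] := Luv'.
by exists b1', b2', (embed u').
Qed.

(** The bijection restricts to the pairs where the last factor enters by a lower
product in (x . y) . z, and where both products are lower in x . (y . z). *)
Lemma triple_lower x y z w :
  (exists b, left_triple b true x y z w) <-> right_triple true true x y z w.
Proof.
case: x y z => [n x] [r y] [s z].
have [phi [_ _ tphi [fphi _ sphi] _]] := dp_assoc P_dendriform x y z.
have {}tphi p : Lset x y z p -> embed (phi p).2 = embed p.2 := tphi p.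
have sub p : Llower x y z p -> Lset x y z p.
  move=> [xy uz]; split=> //; apply/full_side.
  by exists true; apply/side_embed.
split.
  move=> [b [_ [u su ->] [v sv ->]]].
  have Luv : Llower x y z (u, v).
    by split=> //=; apply/full_side; exists b; exists u.
  have := tphi _ (sub _ Luv); have [] := fphi _ Luv.
  by case: (phi _) => u' v' /= su' sv' <-; exists (embed u'); apply/side_embed.
move=> [_ [u su ->] [v sv ->]].
have Ruv : Rlower x y z (u, v) by split.
have [[u' v'] Luv' ephi] := sphi _ Ruv.
have := tphi _ (sub _ Luv'); rewrite ephi /= => ->.
have [/= /full_side[b su'] sv'] := Luv'.
by exists b, (embed u') => //; apply/side_embed.
Qed.

(** The bijection restricts to the pairs where both products are upper in
(x . y) . z, and where the first factor enters by an upper product in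
x . (y . z). *)
Lemma triple_upper x y z w :
  left_triple false false x y z w <-> (exists b, right_triple b false x y z w).
Proof.
case: x y z => [n x] [r y] [s z].
have [phi [_ _ tphi _ [fphi _ sphi]]] := dp_assoc P_dendriform x y z.
have {}tphi p : Lset x y z p -> embed (phi p).2 = embed p.2 := tphi p.
have sub p : Lupper x y z p -> Lset x y z p.
  by move=> [xy uz]; split; apply/full_side; exists false; apply/side_embed.
split.
  move=> [_ [u su ->] [v sv ->]].
  have Luv : Lupper x y z (u, v) by split.
  have := tphi _ (sub _ Luv); have [] := fphi _ Luv.
  case: (phi _) => u' v' /= /full_side[b su'] sv' <-.
  by exists b, (embed u') => //; apply/side_embed.
move=> [b [_ [u su ->] [v sv ->]]].
have Ruv : Rupper x y z (u, v).
  by split=> //=; apply/full_side; exists b; exists u.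
have [[u' v'] Luv' ephi] := sphi _ Ruv.
have := tphi _ (sub _ Luv'); rewrite ephi /= => ->.
by have [/= su' sv'] := Luv'; exists (embed u'); apply/side_embed.
Qed.

Lemma left_triple_type b1 b2 b1' b2' x y z w :
  left_triple b1 b2 x y z w -> left_triple b1' b2' x y z w ->
  b1 = b1' /\ b2 = b2'.
Proof.
move=> [u s1 s2] [u' s1' s2'].
have [uu' _] : u = u' /\ z = z.
  by apply: (side_factors s2 s2'); rewrite (side_tag s1) (side_tag s1').
by subst u'; split; [exact: side_disjoint s1 s1'|exact: side_disjoint s2 s2'].
Qed.

Lemma right_triple_type b1 b2 b1' b2' x y z w :
  right_triple b1 b2 x y z w -> right_triple b1' b2' x y z w ->
  b1 = b1' /\ b2 = b2'.
Proof.
move=> [u s1 s2] [u' s1' s2'].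
have [_ uu'] := side_factors s2 s2' erefl.
by subst u'; split; [exact: side_disjoint s1 s1'|exact: side_disjoint s2 s2'].
Qed.

(** Both sides are what remains of [triple_any] once the types matched by
[triple_lower] and [triple_upper] are excluded. *)
Lemma triple_middle x y z w :
  left_triple true false x y z w <-> right_triple false true x y z w.
Proof.
split=> h.
  have [b1 [b2 h']] : exists b1 b2, right_triple b1 b2 x y z w.
    by apply/triple_any; exists true, false.
  case: b2 h' => h'; last first.
    have : left_triple false false x y z w by apply/triple_upper; exists b1.
    by move=> /(left_triple_type h)[].
  case: b1 h' => // h'.
  have [b] : exists b, left_triple b true x y z w by apply/triple_lower.
  by move=> /(left_triple_type h)[].
have [b1 [b2 h']] : exists b1 b2, left_triple b1 b2 x y z w.
  by apply/triple_any; exists false, true.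
case: b2 h' => h'.
  have : right_triple true true x y z w by apply/triple_lower; exists b1.
  by move=> /(right_triple_type h)[].
case: b1 h' => // h'.
have [b] : exists b, right_triple b false x y z w by apply/triple_upper.
by move=> /(right_triple_type h)[].
Qed.

End Pointwise.

(** * Products of chains, entry by entry *)

Section Tuples.
Variables (d : Order.disp_t) (P : graded_poset4 d) (m : nat).
Hypothesis P_dendriform : is_dendriform_poset P.
Hypothesis m_gt0 : (0 < m)%N.

Local Notation simp := {n : nat & Simp P m n}.
Local Notation elt := (elt P).

Definition entry (w : simp) (k : 'I_m) : elt :=
  embed (tnth (val (tagged w)) k).

Local Notation side_at b x y w k :=
  (side b (entry x k) (entry y k) (entry w k)).
Local Notation left_at b1 b2 x y z w k :=
  (left_triple b1 b2 (entry x k) (entry y k) (entry z k) (entry w k)).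
Local Notation right_at b1 b2 x y z w k :=
  (right_triple b1 b2 (entry x k) (entry y k) (entry z k) (entry w k)).

Lemma entry_mono w (k k' : 'I_m) : (k <= k')%N -> tle (entry w k) (entry w k').
Proof.
case: w => n [t t_sorted] kk'; exists n, (tnth t k), (tnth t k'); split => //=.
pose x0 := tnth t k; rewrite !(tnth_nth x0).
by apply: sorted_leq_nth => //; [exact: le_trans|rewrite inE size_tuple..].
Qed.

Lemma entry_inj u w : (forall k, entry u k = entry w k) -> u = w.
Proof.
move=> uw; have := congr1 tag (uw (Ordinal m_gt0)).
case: u w uw => [n u] [r w] /= uw nr; subst r.
congr (Tagged _); apply/val_inj/eq_from_tnth => k; exact: embed_inj (uw k).
Qed.

Lemma entry_surj n (f : 'I_m -> elt) : (forall k, tag (f k) = n) ->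
  (forall k k' : 'I_m, (k <= k')%N -> tle (f k) (f k')) ->
  exists u, forall k, entry u k = f k.
Proof.
move=> tag_f mono_f; have /choice[g fg] k : exists x : P n, f k = embed x.
  by case: (f k) (tag_f k) => l x /= ln; subst l; exists x.
have g_sorted : sorted <=%O [tuple g k | k < m].
  have x0 := g (Ordinal m_gt0).
  apply/(sortedP x0) => i; rewrite size_tuple => i_lt.
  have lt_im := ltnW i_lt.
  rewrite -(tnth_nth x0 _ (Ordinal lt_im)) -(tnth_nth x0 _ (Ordinal i_lt)).
  by rewrite !tnth_mktuple; apply: tle_embed; rewrite -!fg; apply: mono_f => /=.
exists (Tagged (Simp P m) (exist _ [tuple g k | k < m] g_sorted)) => k.
by rewrite fg /entry /= tnth_mktuple.
Qed.

Definition in_product (i : nat) (x y w : simp) : Prop :=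
  forall k : 'I_m, side_at (k < m - i)%N x y w k.

Lemma in_productP (i : 'I_m.+1) x y w :
  in_product i x y w <->
  exists2 u, Iset i (tagged x) (tagged y) u & w = Tagged (Simp P m) u.
Proof.
split=> [xyw|[u xyu ->] k]; last first.
  by exists (tnth (val u) k) => //; have := xyu k; case: ifP.
have := side_tag (xyw (Ordinal m_gt0)); case: w xyw => l u xyu /= tl.
subst l; exists u => // k; have [v + /embed_inj ->] := xyu k.
by case: ifP.
Qed.

Lemma in_product_tag i x y w : in_product i x y w -> tag w = (tag x + tag y).+1.
Proof. by move=> /(_ (Ordinal m_gt0))/side_tag. Qed.

Lemma in_product_factors i i' x y x' y' w :
  in_product i x y w -> in_product i' x' y' w -> tag x = tag x' ->
  x = x' /\ y = y'.
Proof.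
move=> s s' t.
have h k := side_factors P_dendriform (s k) (s' k) t.
by split; apply: entry_inj => k; have [] := h k.
Qed.

(** The index is the number of upper entries. *)
Lemma in_product_index i i' x y w : (i <= m)%N -> (i' <= m)%N ->
  in_product i x y w -> in_product i' x y w -> i = i'.
Proof.
wlog le_ii' : i i' / (i <= i')%N.
  move=> H; case: (leqP i i') => [|/ltnW] le_ii' im i'm s s'; first exact: H.
  by apply/esym/H.
move=> im i'm s s'; apply/eqP; case: (ltngtP i i') le_ii' => // lt_ii' _.
have lt_km : (m - i' < m)%N by rewrite ltn_subrL m_gt0 (leq_trans _ lt_ii').
have := side_disjoint P_dendriform (s (Ordinal lt_km)) (s' (Ordinal lt_km)).
by rewrite /= ltnn ltn_sub2l // (leq_trans lt_ii').
Qed.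

(** Separation: a chain never goes from the upper part down to the lower one. *)
Lemma side_lower_down x y u (k k' : 'I_m) b : (k <= k')%N ->
  side true (entry x k') (entry y k') (entry u k') ->
  side_at b x y u k -> b = true.
Proof.
move=> kk' s'; case: b => // s.
by case: (side_separated P_dendriform s' s erefl (entry_mono u kk')).
Qed.

Lemma in_product_exists x y u :
  (forall k, exists b, side_at b x y u k) ->
  exists2 i, (i <= m)%N & in_product i x y u.
Proof.
move=> /choice[b s].
(* The first m - i entries are lower for m - i the least t beyond which all
   entries are upper. *)
pose Q t := [forall k : 'I_m, (t <= k)%N ==> ~~ b k].
have exQ : exists t, Q t.
  by exists m; apply/forallP => k; rewrite leqNgt ltn_ord.
case: (ex_minnP exQ) => t Qt min_t.
have le_tm : (t <= m)%N.
  by apply: min_t; apply/forallP => k; rewrite leqNgt ltn_ord.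
exists (m - t)%N; first exact: leq_subr.
move=> k; rewrite subKn //; case: (ltnP k t) => [lt_kt|le_tk]; last first.
  have /implyP/(_ le_tk)/negbTE <- := forallP Qt k.
  exact: s.
have t_gt0 : (0 < t)%N by apply: leq_trans lt_kt.
have : ~~ Q t.-1 by apply/negP => /min_t; rewrite leqNgt prednK ?leqnn.
rewrite negb_forall => /existsP[k']; rewrite negb_imply negbK => /andP[tk' bk'].
have le_kk' : (k <= k')%N by apply: leq_trans tk'; rewrite -ltnS prednK.
have s' := s k'; rewrite bk' in s'.
by rewrite -(side_lower_down le_kk' s' (s k)).
Qed.

(** The intermediate elements u_k exist one by one and increase with k because
the w_k do. They are unique, so that one chain serves for all types. *)
Lemma left_triple_chain x y z w :
  (forall k, exists b1 b2, left_at b1 b2 x y z w k) ->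
  exists u, forall k b1 b2, left_at b1 b2 x y z w k ->
    side_at b1 x y u k /\ side_at b2 u z w k.
Proof.
move=> /choice[b1]/choice[b2] h.
have /choice[f fP] k : exists u, side (b1 k) (entry x k) (entry y k) u /\
   side (b2 k) u (entry z k) (entry w k) by have [u] := h k; exists u.
have tag_f k : tag (f k) = (tag x + tag y).+1 by have [/side_tag-> _] := fP k.
have [k k' kk'|u uf] := entry_surj tag_f.
  have [_ s] := fP k; have [_ s'] := fP k'.
  have tt : tag (f k) = tag (f k') by rewrite !tag_f.
  by have [] := side_mono P_dendriform s s' tt (entry_mono w kk').
exists u => k c1 c2 [v s1 s2]; rewrite uf; have [_ s2'] := fP k.
suff [<- _] : v = f k /\ entry z k = entry z k by [].
by apply: (side_factors P_dendriform s2 s2'); rewrite tag_f (side_tag s1).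
Qed.

Lemma right_triple_chain x y z w :
  (forall k, exists b1 b2, right_at b1 b2 x y z w k) ->
  exists u, forall k b1 b2, right_at b1 b2 x y z w k ->
    side_at b1 y z u k /\ side_at b2 x u w k.
Proof.
move=> /choice[b1]/choice[b2] h.
have /choice[f fP] k : exists u, side (b1 k) (entry y k) (entry z k) u /\
   side (b2 k) (entry x k) u (entry w k) by have [u] := h k; exists u.
have tag_f k : tag (f k) = (tag y + tag z).+1 by have [/side_tag-> _] := fP k.
have [k k' kk'|u uf] := entry_surj tag_f.
  have [_ s] := fP k; have [_ s'] := fP k'.
  by have [] := side_mono P_dendriform s s' erefl (entry_mono w kk').
exists u => k c1 c2 [v s1 s2]; rewrite uf; have [_ s2'] := fP k.
by have [_ <-] := side_factors P_dendriform s2 s2' erefl.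
Qed.

(** The indices are in the order in which they are read in x *_i (y *_j z) and
(x *_i y) *_j z. *)
Definition right_chain_triple i j x y z w :=
  exists2 u, in_product j y z u & in_product i x u w.
Definition left_chain_triple i j x y z w :=
  exists2 u, in_product i x y u & in_product j u z w.

(** The types found entry by entry leave the inner one open for k < m - j. It
is lower there because it is lower at k = m - j, an index which is in the middle
range since i < j. *)
Lemma left_of_right_chain_triple i j x y z w : (i < j)%N -> (j <= m)%N ->
  right_chain_triple i j x y z w -> left_chain_triple i j x y z w.
Proof.
move=> lt_ij le_jm [u' s1 s2].
have im := leq_trans lt_ij le_jm.
have lt_sub : (m - j < m - i)%N by rewrite ltn_sub2l.
(* The type is (any, lower), then (lower, upper), then (upper, upper). *)
have h (k : 'I_m) : exists b,
    left_at (b || (m - j <= k < m - i))%N (k < m - j)%N x y z w k /\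
    ((m - i <= k)%N -> ~~ b).
  have := s2 k; have := s1 k; case: (ltnP k (m - j)) => kj; last first.
    case: (ltnP k (m - i)) => ki /= t1 t2; exists false; split=> //.
      by apply/(triple_middle P_dendriform); exists (entry u' k).
    apply/(triple_upper P_dendriform); exists false; exists (entry u' k) => //.
  rewrite (ltn_trans kj lt_sub) => t1 t2.
  have [b t] : exists b, left_at b true x y z w k.
    by apply/(triple_lower P_dendriform); exists (entry u' k).
  exists b; rewrite orbF; split=> //.
  by rewrite leqNgt (ltn_trans kj lt_sub).
have [|u su] := @left_triple_chain x y z w.
  by move=> k; have [b [s _]] := h k; do 2 eexists; exact: s.
exists u => k; have [b [/su[t1 t2] hk]] := h k => //.
have lt_km : (m - j < m)%N by rewrite ltn_subrL m_gt0 (leq_trans _ lt_ij).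
have t0 : side_at true x y u (Ordinal lt_km).
  by have [b' [/su[+ _] _]] := h (Ordinal lt_km); rewrite /= leqnn lt_sub orbT.
case: (ltnP k (m - i)) hk t1 => ki.
  move=> _; case: (leqP (m - j) k) => kj; first by rewrite orbT.
  move=> s; have := @side_lower_down _ _ _ k (Ordinal lt_km) _ (ltnW kj) t0 s.
  by move=> e; move: s; rewrite e.
by move=> /(_ isT)/negbTE->; rewrite andbF.
Qed.

(** Dually, the inner type is open for m - i <= k, and upper there because it is
upper at k = m - j. *)
Lemma right_of_left_chain_triple i j x y z w : (i < j)%N -> (j <= m)%N ->
  left_chain_triple i j x y z w -> right_chain_triple i j x y z w.
Proof.
move=> lt_ij le_jm [u' s1 s2].
have im := leq_trans lt_ij le_jm.
have lt_sub : (m - j < m - i)%N by rewrite ltn_sub2l.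
(* The type is (lower, lower), then (upper, lower), then (any, upper). *)
have h (k : 'I_m) : exists b,
    right_at (b && ~~ (m - j <= k < m - i))%N (k < m - i)%N x y z w k /\
    ((k < m - j)%N -> b).
  have := s2 k; have := s1 k; case: (ltnP k (m - i)) => ki; last first.
    rewrite ltnNge (ltnW (leq_trans lt_sub ki)) /= => t1 t2.
    have [b t] : exists b, right_at b false x y z w k.
      by apply/(triple_upper P_dendriform); exists (entry u' k).
    by exists b; rewrite andbT.
  case: (ltnP k (m - j)) => kj t1 t2; exists true; split=> //=.
    by apply/(triple_lower P_dendriform); exists true; exists (entry u' k).
  by apply/(triple_middle P_dendriform); exists (entry u' k).
have [|u su] := @right_triple_chain x y z w.
  by move=> k; have [b [s _]] := h k; do 2 eexists; exact: s.
exists u => k; have [b [/su[t1 t2] hk]] := h k => //.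
have lt_km : (m - j < m)%N by rewrite ltn_subrL m_gt0 (leq_trans _ lt_ij).
have t0 : side_at false y z u (Ordinal lt_km).
  by have [b' [/su[+ _] _]] := h (Ordinal lt_km); rewrite /= leqnn lt_sub andbF.
case: (ltnP k (m - j)) hk t1 => kj.
  by move=> /(_ isT)->.
move=> _; case: (leqP (m - i) k) => ki; last by rewrite andbF.
rewrite andbT; case: b {t2} => //= s.
by have := @side_lower_down _ _ _ (Ordinal lt_km) k false kj s t0.
Qed.

Lemma chain_triple_assoc i j x y z w : (i < j)%N -> (j <= m)%N ->
  right_chain_triple i j x y z w <-> left_chain_triple i j x y z w.
Proof.
move=> ij jm; split; first exact: left_of_right_chain_triple.
exact: right_of_left_chain_triple.
Qed.

(** In (x . y) . z the inner type is upper from m - i on and open before, so its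
threshold m - k is any number at most m - i; in x . (y . z) the inner type is
lower before m - i and open afterwards, so its threshold m - j is at least
m - i. *)
Lemma chain_triple_sum i x y z w : (i <= m)%N ->
  (exists j, (j <= i)%N /\ right_chain_triple i j x y z w) <->
  (exists k, (i <= k <= m)%N /\ left_chain_triple k i x y z w).
Proof.
move=> im; split=> [[j [ji [u' s1 s2]]]|[j [/andP[ij jm] [u' s1 s2]]]].
  have le_sub : (m - i <= m - j)%N by rewrite leq_sub2l.
  have h (k : 'I_m) : exists b,
      left_at (b && (k < m - i))%N (k < m - i)%N x y z w k.
    have := s2 k; have := s1 k; case: (ltnP k (m - i)) => ki t1 t2.
      rewrite (leq_trans ki le_sub) in t1.
      have [b t] : exists b, left_at b true x y z w k.
        by apply/(triple_lower P_dendriform); exists (entry u' k).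
      by exists b; rewrite andbT.
    exists false; apply/(triple_upper P_dendriform).
    by eexists; exists (entry u' k); eassumption.
  have [|u su] := @left_triple_chain x y z w.
    by move=> k; have [b s] := h k; do 2 eexists; exact: s.
  have [|l lm sl] := @in_product_exists x y u.
    by move=> k; have [b /su[s _]] := h k; eexists; exact: s.
  exists l; split; last first.
    by exists u => // k; have [b /su[_ s]] := h k.
  rewrite lm andbT leqNgt; apply/negP => li.
  have lt_km : (m - i < m)%N by rewrite ltn_subrL m_gt0 (leq_trans _ li).
  have := sl (Ordinal lt_km); have [b /su[/= + _]] := h (Ordinal lt_km).
  rewrite ltnn andbF ltn_sub2l // ?(leq_trans li) //.
  by move=> s s'; have := side_disjoint P_dendriform s s'.
have le_sub : (m - j <= m - i)%N by rewrite leq_sub2l.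
have h (k : 'I_m) : exists b,
    right_at (b || (k < m - i))%N (k < m - i)%N x y z w k.
  have := s2 k; have := s1 k; case: (ltnP k (m - i)) => ki t1 t2.
    exists true; apply/(triple_lower P_dendriform).
    by eexists; exists (entry u' k); eassumption.
  rewrite ltnNge (leq_trans le_sub ki) in t1.
  have [b t] : exists b, right_at b false x y z w k.
    by apply/(triple_upper P_dendriform); exists (entry u' k).
  by exists b; rewrite orbF.
have [|u su] := @right_triple_chain x y z w.
  by move=> k; have [b s] := h k; do 2 eexists; exact: s.
have [|l lm sl] := @in_product_exists y z u.
  by move=> k; have [b /su[s _]] := h k; eexists; exact: s.
exists l; split; last first.
  by exists u => // k; have [b /su[_ s]] := h k.
rewrite leqNgt; apply/negP => il.
have lt_km : (m - l < m)%N by rewrite ltn_subrL m_gt0 (leq_trans _ il).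
have := sl (Ordinal lt_km); have [b /su[/= + _]] := h (Ordinal lt_km).
rewrite ltnn ltn_sub2l ?(leq_trans il) // orbT.
by move=> s s'; have := side_disjoint P_dendriform s s'.
Qed.

End Tuples.

(** * Linear maps on a space of finitely supported functions *)

Lemma big_indicator (K : nzRingType) (I : eqType) (s : seq I) (Q : I -> Prop) :
  uniq s -> {in s &, forall a b, Q a -> Q b -> a = b} ->
  \sum_(a <- s) (`[< Q a >]%:R : K) = `[< exists2 a, a \in s & Q a >]%:R.
Proof.
move=> s_uniq Q_uniq; case: asboolP => [[a sa Qa]|noQ]; last first.
  rewrite big_seq big1 // => a sa; case: asboolP => // Qa.
  by case: noQ; exists a.
rewrite (big_rem a) //= asboolT // big_seq big1 ?addr0 // => b.
rewrite mem_rem_uniq // inE => /andP[ba sb]; rewrite asboolF // => Qb.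
by move: ba; rewrite (Q_uniq b a) ?eqxx.
Qed.

Lemma eq_indicator (K : nzRingType) (Q Q' : Prop) : (Q <-> Q') ->
  `[< Q >]%:R = `[< Q' >]%:R :> K.
Proof. by move=> QQ'; rewrite (asbool_equiv_eq QQ'). Qed.

Section LinearExtension.
Variables (R : comNzRingType) (X : choiceType).
Local Notation A := {malg R[X]}.

Section Extend.
Variables (V : lmodType R) (h : X -> V).

Definition malg_ext (f : A) : V := \sum_(a <- msupp f) f@_a *: h a.

Lemma malg_extEw (D : {fset X}) (f : A) :
  (msupp f `<=` D)%fset -> malg_ext f = \sum_(a <- D) f@_a *: h a.
Proof.
move=> fD; apply: big_fset_incl => // a _ a_notin.
by rewrite mcoeff_outdom // scale0r.
Qed.

Lemma malg_ext_linear : linear malg_ext.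
Proof.
move=> c f g; pose D := (msupp f `|` msupp g)%fset.
have fD : (msupp f `<=` D)%fset by apply: fsubsetUl.
have gD : (msupp g `<=` D)%fset by apply: fsubsetUr.
have cfgD : (msupp (c *: f + g) `<=` D)%fset.
  apply: fsubset_trans (msuppD_le _ _) _; apply: fsetSU; exact: msuppZ_le.
rewrite (malg_extEw fD) (malg_extEw gD) (malg_extEw cfgD).
rewrite scaler_sumr -big_split.
by apply: eq_bigr => a _; rewrite mcoeffD mcoeffZ scalerDl scalerA.
Qed.

Lemma malg_extU a : malg_ext << a >> = h a.
Proof. by rewrite /malg_ext msuppU oner_eq0 big_seq_fset1 mcoeffUU scale1r. Qed.

End Extend.

Lemma raw_linear_sum (V : lmodType R) (F : A -> V) (I : Type) (s : seq I)
    (P : pred I) (g : I -> A) :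
  linear F -> F (\sum_(a <- s | P a) g a) = \sum_(a <- s | P a) F (g a).
Proof.
move=> F_lin.
pose G : {linear A -> V} :=
  HB.pack F (GRing.isLinear.Build R A V _ F F_lin).
exact: (linear_sum G).
Qed.

Lemma linear_malg_eq (V : lmodType R) (F G : A -> V) :
  linear F -> linear G -> (forall a, F << a >> = G << a >>) ->
  forall f, F f = G f.
Proof.
move=> F_lin G_lin FG f.
have Z (H : A -> V) : linear H -> forall c a, H << c *g a >> = c *: H << a >>.
  move=> H_lin c a; pose L : {linear A -> V} :=
    HB.pack H (GRing.isLinear.Build R A V _ H H_lin).
  have -> : << c *g a >> = c *: << a >> :> A.
    by apply/malgP => k; rewrite mcoeffZ !mcoeffU mulr_natr.
  exact: (linearZ_LR L).
rewrite (monalgE f) !raw_linear_sum //.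
by apply: eq_bigr => a _; rewrite (Z F) // (Z G) // FG.
Qed.

End LinearExtension.

(** * The products of the space of chains *)

Section OrdMul.
Variables (K : fieldType) (d : Order.disp_t) (P : graded_poset4 d) (m : nat).
Hypothesis P_dendriform : is_dendriform_poset P.
Hypothesis P_finite :
  forall (n r : nat) (x : P n) (y : P r), finite_set (full x y).
Hypothesis m_gt0 : (0 < m)%N.

Local Notation simp := {n : nat & Simp P m n}.
Local Notation Ord := (Ord K P m).
Local Notation Ord_mul := (@Ord_mul K d P m).
Local Notation basis := (fun a : simp => (<< a >> : Ord)).

(** The entries of the chains in question lie in finitely many intervals, hence
in the finite set of the terms of a sequence. *)
Lemma finite_Iset (i : 'I_m.+1) n r (x : Simp P m n) (y : Simp P m r) :
  finite_set (Iset i x y).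
Proof.
have [s sP] : exists s : seq (P (n + r).+1), forall (u : Simp P m (n + r).+1) j,
    Iset i x y u -> tnth (val u) j \in s.
  have /choice[s sP] (j : 'I_m) : exists s : seq (P (n + r).+1),
     full (tnth (val x) j) (tnth (val y) j) = [set` s]%classic.
    exact/finite_seqP/P_finite.
  exists (flatten [seq s j | j <- enum 'I_m]) => u j xyu.
  apply/flatten_mapP; exists j; first by rewrite mem_enum.
  suff : full (tnth (val x) j) (tnth (val y) j) (tnth (val u) j) by rewrite sP.
  have [-> _] := dp_split P_dendriform (tnth (val x) j) (tnth (val y) j).
  by have /= := xyu j; case: ifP => _ ?; [left|right].
pose B := [set t : m.-tuple (P (n + r).+1) | forall j, tnth t j \in s]%classic.
have B_finite : finite_set B.
  apply: (@sub_finite_set _ _ (range (fun f : {ffun 'I_m -> seq_sub s} =>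
    [tuple ssval (f j) | j < m]))).
    move=> t tB; exists [ffun j => SeqSub (tB j)] => //.
    by apply: eq_from_tnth => j; rewrite tnth_mktuple ffunE.
  exact/finite_image/finite_finset.
apply: (@sub_finite_set _ _ (val @^-1` B)%classic).
  by move=> u xyu j; exact: sP.
apply: finite_preimage => // u v _ _; exact: val_inj.
Qed.

Lemma Ord_basis_mul_seq (i : 'I_m.+1) (a b : simp) : exists s : seq simp,
  [/\ uniq s, forall w, w \in s <-> in_product i a b w &
      Ord_basis_mul K i a b = \sum_(w <- s) basis w].
Proof.
have I_fin := finite_Iset i (tagged a) (tagged b).
exists [seq Tagged (Simp P m) u | u <- fset_set (Iset i (tagged a) (tagged b))].
split.
- by rewrite map_inj_uniq ?fset_uniq //; exact: Tagged_inj.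
- move=> w; rewrite in_productP //; split=> [/mapP[u]|[u uI ->]].
    by rewrite in_fset_set // inE => uI ->; exists u.
  by apply: map_f; rewrite in_fset_set ?inE.
- by rewrite /Ord_basis_mul fsbig_finite // big_map.
Qed.

Lemma mcoeff_Ord_basis_mul (i : 'I_m.+1) (a b w : simp) :
  (Ord_basis_mul K i a b)@_w = `[< in_product i a b w >]%:R.
Proof.
have [s [s_uniq sP ->]] := Ord_basis_mul_seq i a b.
rewrite raddf_sum /=; under eq_bigr do rewrite mcoeffU -[_ == w]asboolb.
rewrite big_indicator // => [|u v _ _ /eqP -> /eqP //].
apply: eq_indicator.
by rewrite -sP; split=> [[u + /eqP<-]|ws] //; exists w.
Qed.

Lemma Ord_mulE i (f g : Ord) : Ord_mul i f g =
  malg_ext (fun a => malg_ext (fun b => Ord_basis_mul K i a b) g) f.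
Proof.
apply: eq_bigr => a _; rewrite scaler_sumr.
by apply: eq_bigr => b _; rewrite scalerA.
Qed.

Lemma Ord_mul_linearl i g : linear (Ord_mul i ^~ g).
Proof. by move=> c f f'; rewrite /= !Ord_mulE malg_ext_linear. Qed.

Lemma Ord_mul_linearr i f : linear (Ord_mul i f).
Proof.
move=> c g g'; rewrite !Ord_mulE scaler_sumr -big_split.
apply: eq_bigr => a _; rewrite malg_ext_linear scalerDr !scalerA.
by rewrite [c * _]mulrC.
Qed.

Lemma Ord_mulU i a b : Ord_mul i (basis a) (basis b) = Ord_basis_mul K i a b.
Proof. by rewrite Ord_mulE !malg_extU. Qed.

(** The coefficient counts the intermediate chains, and there is at most one of
them, by [in_product_factors]. *)
Lemma mcoeff_Ord_mul_right i j (x y z w : simp) :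
  (Ord_mul i (basis x) (Ord_mul j (basis y) (basis z)))@_w
  = `[< right_chain_triple i j x y z w >]%:R.
Proof.
have [s [s_uniq sP sE]] := Ord_basis_mul_seq j y z.
rewrite Ord_mulU sE (raw_linear_sum _ _ _ (Ord_mul_linearr i (basis x))).
rewrite raddf_sum /=.
under eq_bigr do rewrite Ord_mulU mcoeff_Ord_basis_mul.
rewrite big_indicator //.
  apply: eq_indicator.
  by split=> [[u /sP]|[u /sP]]; exists u.
move=> u v _ _ s1 s2.
by have [] := in_product_factors P_dendriform m_gt0 s1 s2 erefl.
Qed.

Lemma mcoeff_Ord_mul_left i j (x y z w : simp) :
  (Ord_mul j (Ord_mul i (basis x) (basis y)) (basis z))@_w
  = `[< left_chain_triple i j x y z w >]%:R.
Proof.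
have [s [s_uniq sP sE]] := Ord_basis_mul_seq i x y.
rewrite Ord_mulU sE (raw_linear_sum _ _ _ (Ord_mul_linearl j (basis z))).
rewrite raddf_sum /=.
under eq_bigr do rewrite Ord_mulU mcoeff_Ord_basis_mul.
rewrite big_indicator //.
  apply: eq_indicator.
  by split=> [[u /sP]|[u /sP]]; exists u.
move=> u v /sP/(in_product_tag m_gt0) tu /sP/(in_product_tag m_gt0) tv s1 s2.
have uv : tag u = tag v by rewrite tu.
by have [] := in_product_factors P_dendriform m_gt0 s1 s2 uv.
Qed.

Definition trilinear (F : Ord -> Ord -> Ord -> Ord) :=
  [/\ forall y z, linear (fun x => F x y z),
      forall x z, linear (fun y => F x y z) & forall x y, linear (F x y)].

Lemma trilinear_eq F G : trilinear F -> trilinear G ->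
  (forall a b c,
    F (basis a) (basis b) (basis c) = G (basis a) (basis b) (basis c)) ->
  forall x y z, F x y z = G x y z.
Proof.
move=> [F1 F2 F3] [G1 G2 G3] FG x y z.
apply: (linear_malg_eq (F1 y z) (G1 y z)) => a.
apply: (linear_malg_eq (F2 _ z) (G2 _ z)) => b.
exact: (linear_malg_eq (F3 _ _) (G3 _ _)).
Qed.

Lemma trilinear_right i j :
  trilinear (fun x y z => Ord_mul i x (Ord_mul j y z)).
Proof.
split=> [y z|x z|x y] c f g.
- exact: (Ord_mul_linearl i).
- by rewrite (Ord_mul_linearl j) Ord_mul_linearr.
- by rewrite (Ord_mul_linearr j) Ord_mul_linearr.
Qed.

Lemma trilinear_left i j : trilinear (fun x y z => Ord_mul j (Ord_mul i x y) z).
Proof.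
split=> [y z|x z|x y] c f g.
- by rewrite (Ord_mul_linearl i) (Ord_mul_linearl j).
- by rewrite (Ord_mul_linearr i) (Ord_mul_linearl j).
- exact: Ord_mul_linearr.
Qed.

Lemma trilinear_sum (I : Type) (s : seq I) (Q : pred I) F :
  (forall i, trilinear (F i)) ->
  trilinear (fun x y z => \sum_(i <- s | Q i) F i x y z).
Proof.
move=> F3; split=> [y z|x z|x y] c f g; rewrite scaler_sumr -big_split;
  apply: eq_bigr => i _; case: (F3 i) => F1 F2 {}F3.
- exact: F1.
- exact: F2.
- exact: F3.
Qed.

Lemma Ord_mul_assoc (i j : 'I_m.+1) x y z : (i < j)%N ->
  Ord_mul i x (Ord_mul j y z) = Ord_mul j (Ord_mul i x y) z.
Proof.
move=> ij.
apply: (trilinear_eq (trilinear_right i j) (trilinear_left i j)) => a b c.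
apply/malgP => w; apply: etrans (mcoeff_Ord_mul_right i j a b c w) _.
apply: etrans (esym (mcoeff_Ord_mul_left i j a b c w)).
apply: eq_indicator.
by apply: chain_triple_assoc => //; rewrite -ltnS.
Qed.

(** At most one index contributes to each coefficient: the intermediate chain is
determined by [in_product_factors], and its index by [in_product_index]. So both
sums of coefficients are again 0 or 1. *)
Lemma Ord_mul_sum (i : 'I_m.+1) x y z :
  \sum_(j < m.+1 | (j <= i)%N) Ord_mul i x (Ord_mul j y z) =
  \sum_(k < m.+1 | (i <= k)%N) Ord_mul i (Ord_mul k x y) z.
Proof.
apply: (trilinear_eq
  (trilinear_sum (index_enum 'I_m.+1) (fun j => j <= i)%N (trilinear_right i))
  (trilinear_sum (index_enum 'I_m.+1) (fun k => i <= k)%N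
    (fun k => trilinear_left k i))).
move=> a b c; apply/malgP => w; rewrite !raddf_sum /=.
apply: etrans (eq_bigr _ (fun j _ => mcoeff_Ord_mul_right i j a b c w)) _.
apply: etrans (esym (eq_bigr _ (fun k _ => mcoeff_Ord_mul_left k i a b c w))).
rewrite -!(big_filter (index_enum _)).
rewrite !big_indicator ?filter_uniq ?index_enum_uniq //.
- apply: eq_indicator.
  transitivity (exists j, (j <= i)%N /\ right_chain_triple i j a b c w).
    split=> [[j]|[j [ji s]]].
      by rewrite mem_filter => /andP[ji _]; exists j.
    have jm : (j < m.+1)%N by apply: leq_ltn_trans ji _.
    by exists (Ordinal jm); rewrite // mem_filter ji mem_index_enum.
  have im : (i <= m)%N by rewrite -ltnS.
  rewrite (chain_triple_sum P_dendriform m_gt0 _ _ _ _ im).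
  split=> [[k [/andP[ik km] s]]|[k]]; last first.
    by rewrite mem_filter => /andP[ik _] s; exists k; rewrite ik -ltnS ltn_ord.
  rewrite -ltnS in km.
  by exists (Ordinal km); rewrite // mem_filter ik mem_index_enum.
- move=> k k' _ _ [u s1 s2] [u' s1' s2']; apply/val_inj.
  have tt : tag u = tag u'.
    by rewrite (in_product_tag m_gt0 s1) (in_product_tag m_gt0 s1').
  have [e _] := in_product_factors P_dendriform m_gt0 s2 s2' tt; subst u'.
  apply: (in_product_index P_dendriform m_gt0 _ _ s1 s1');
    by rewrite -ltnS ltn_ord.
- move=> j j' _ _ [u s1 s2] [u' s1' s2']; apply/val_inj.
  have [_ e] := in_product_factors P_dendriform m_gt0 s2 s2' erefl; subst u'.
  apply: (in_product_index P_dendriform m_gt0 _ _ s1 s1');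
    by rewrite -ltnS ltn_ord.
Qed.

End OrdMul.

Theorem theorem3p3p6 (K : fieldType) (d : Order.disp_t) (P : graded_poset4 d)
  (P_dendriform : is_dendriform_poset P)
  (P_finite : forall (n r : nat) (x : P n) (y : P r), finite_set (full x y))
  (m : nat) (m_ge1 : (1 <= m)%N) :
  @is_Dyck_algebra K m (Ord K P m) (@Ord_mul K d P m).
Proof.
split; [exact: Ord_mul_linearl|exact: Ord_mul_linearr| |].
- exact: Ord_mul_assoc.
- exact: Ord_mul_sum.
Qed.
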